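(* Fix $\bm\theta\in\Theta$ and a non-anticipating allocation algorithm whose empirical allocation sequence $(\bm p_t)_{t\ge1}$ satisfies the LDP upper bound with rate function $I:\Sigma_K\to[0,\infty]$. Let $n\in\{2,\dots,K\}$ and $J\subseteq[K]$ with $|J|=n$ and $I^*\in J$, and set $M=\{\bm\lambda\in\mathbb R^K:\lambda_{I^*}\le\lambda_i\ \forall i\in J\}$. Then for every Borel set $P\subseteq\Sigma_K$, $$\liminf_{t\to\infty}-\frac1t\ln\mathbb P_{\bm\theta}\big(\bm m_t\in M,\ \bm p_t\in P\big)\ \ge\ \inf_{\bm p\in\mathrm{cl}(P)}\max\{F_{\bm\theta,M}(\bm p),I(\bm p)\},$$ where $F_{\bm\theta,M}(\bm p)=\inf_{\bm\lambda\in\mathrm{cl}(M)}\sum_{i=1}^Kp_i\frac{(\lambda_i-\theta_i)^2}{2\sigma^2}$ and $\mathrm{cl}$ denotes closure.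
   Context: Sampling model: $K$ arms with $\bm\theta\in\mathbb R^K$; potential outcomes $Y_{t,i}$ independent with $Y_{t,i}\sim\mathcal N(\theta_i,\sigma^2)$, $\sigma^2>0$. A non-anticipating algorithm chooses arm $I_t$ using only past choices, past observed outcomes $Y_{s,I_s}$ ($s<t$) and independent internal randomization; only $Y_{t,I_t}$ is observed. $\Theta$: $\bm\theta$ with unique best arm $I^*=\arg\max_i\theta_i$. $\Sigma_K$: probability simplex in $\mathbb R^K$. $\bm p_t=(N_{t,i}/t)_{i\in[K]}$ with $N_{t,i}$ the number of the first $t$ units assigned to arm $i$; $\bm m_t=(m_{t,i})_i$ with $m_{t,i}$ the empirical mean of the observed outcomes of arm $i$ among the first $t$ units ($0$ if $N_{t,i}=0$). ''$(\bm p_t)$ satisfies the LDP upper bound with rate function $I$'' means: $I$ is lower semicontinuous and for every closed $F\subseteq\Sigma_K$, $\limsup_{t\to\infty}\frac1t\ln\mathbb P_{\bm\theta}(\bm p_t\in F)\le-\inf_{\bm p\in F}I(\bm p)$. *)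

(* Defs.v *)
From HB Require Import structures.
From mathcomp Require Import all_boot all_order all_algebra.
From mathcomp Require Import all_classical all_reals all_analysis.
Set Implicit Arguments. Unset Strict Implicit. Unset Printing Implicit Defensive.
Import Order.TTheory GRing.Theory Num.Theory.
Import numFieldNormedType.Exports.
Local Open Scope classical_set_scope.
Local Open Scope ring_scope.

Definition eln {R : realType} (r : R) : \bar R :=
  if r == 0 then -oo%E else (ln r)%:E.

Definition simplex {R : realType} (K : nat) : set 'rV[R]_K :=
  [set p | (forall i, 0 <= p 0 i) /\ \sum_(i < K) p 0 i = 1].
Arguments simplex {R} K.

Definition borel_rV {R : realType} (K : nat) : set (set 'rV[R]_K) :=
  <<s [set U : set 'rV[R]_K | open U] >>.
Arguments borel_rV {R} K.

Definition lsc_on {X : topologicalType} {R : realType} (S : set X)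
  (f : X -> \bar R) : Prop :=
  forall x, S x -> forall a : R, (a%:E < f x)%E ->
    exists2 V, nbhs x V & forall y, V y -> S y -> (a%:E < f y)%E.

Definition mutually_independent {d} {T : measurableType d} {R : realType}
  (P : probability T R) {I : eqType} (X : I -> T -> R) : Prop :=
  forall (s : seq I) (B : I -> set R), uniq s ->
    (forall j, j \in s -> measurable (B j)) ->
    P [set w | forall j, j \in s -> B j (X j w)] =
      (\prod_(j <- s) P (X j @^-1` B j))%E.

Section bandit.
Context {d : measure_display} {T : measurableType d} {R : realType} {K : nat}.
Variables (Y : nat -> 'I_K -> T -> R) (arm : nat -> T -> 'I_K).

Definition observed (s : nat) (w : T) : R := Y s (arm s w) w.

(* the family of all potential outcomes (Some (t,i)) and the internal
   randomization (None) *)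
Definition all_vars (U : T -> R) (o : option (nat * 'I_K)) : T -> R :=
  match o with Some (t, i) => Y t i | None => U end.

Definition history_gen (U : T -> R) (t : nat) : set (set T) :=
  [set A | (exists s B, (s < t)%N /\ measurable B /\ A = observed s @^-1` B)
        \/ (exists s (i : 'I_K), (s < t)%N /\ A = arm s @^-1` [set i])
        \/ (exists B, measurable B /\ A = U @^-1` B)].

Definition non_anticipating (U : T -> R) : Prop :=
  forall t (i : 'I_K), <<s history_gen U t >> (arm t @^-1` [set i]).

Definition Ncount (t : nat) (i : 'I_K) (w : T) : nat :=
  \sum_(s < t) (arm s w == i).

Definition p_emp (t : nat) (w : T) : 'rV[R]_K :=
  \row_i ((Ncount t i w)%:R / t%:R).

(* empirical means m_t (0 if N_{t,i} = 0, since x / 0 = 0) *)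
Definition m_emp (t : nat) (w : T) : 'rV[R]_K :=
  \row_i ((\sum_(s < t | arm s w == i) Y s i w) / (Ncount t i w)%:R).
End bandit.

Definition LDP_upper {d} {T : measurableType d} {R : realType} {K : nat}
  (P : probability T R) (pt : nat -> T -> 'rV[R]_K) (I : 'rV[R]_K -> \bar R)
  : Prop :=
  lsc_on (simplex K) I /\
  forall F : set 'rV[R]_K, closed F -> F `<=` simplex K ->
    (limn_esup (fun t => (t%:R^-1)%:E * eln (fine (P [set w | F (pt t w)])))
       <= - ereal_inf (I @` F))%E.

Definition Frate {R : realType} {K : nat} (sigma : R) (theta : 'rV[R]_K)
  (M : set 'rV[R]_K) (p : 'rV[R]_K) : \bar R :=
  ereal_inf [set (\sum_(i < K) p 0 i * (l 0 i - theta 0 i) ^+ 2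
                  / (2 * sigma ^+ 2))%:E | l in closure M].

(* Main.v *)
(** Let G(p, l) = sum_i p_i (l_i - theta_i)^2 / (2 sigma^2), so that F(p) is the
    infimum of G(p, .) over M, and fix a < inf max(F, I) over cl(P).
    On the part of cl(P) where F <= a, which is closed, I > a, so the LDP upper
    bound gives P(p_t in that part) the exponential rate a.
    On {m_t in M, F(p_t) > a}, split according to the at most (t+1)^K possible
    count vectors. For counts with frequencies p, let l be the minimizer of
    G(p, .) over the convex set M. The first-order condition at l gives, for
    every m in M, that the log-likelihood ratio of the mean vector l against
    theta, computed from the counts and the empirical means m, is at least
    t G(p, l) > t a. This likelihood ratio has expectation 1 under every
    non-anticipating allocation, so Markov's inequality bounds the probability
    of each count vector by exp(-t a), and (t+1)^K is subexponential. *)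

Require Import Defs.
From HB Require Import structures.
From mathcomp Require Import all_boot all_order all_algebra.
From mathcomp Require Import all_classical all_reals all_analysis.
Import Order.TTheory GRing.Theory Num.Theory.
From mathcomp Require Import measurable_realfun ring lra.
Import numFieldNormedType.Exports.
Local Open Scope classical_set_scope.
Local Open Scope ring_scope.

(** * Gaussian integrals and exponential tilting *)

(** The Radon-Nikodym derivative of [normal_prob] has the same integral as [normal_pdf] over every
    measurable set, so the two densities agree almost everywhere. *)
Lemma integral_normal_prob (R : realType) (m s : R) (f : measurableTypeR R -> \bar R) :
  measurable_fun setT f -> (forall x, 0 <= f x)%E ->
  (\int[normal_prob m s]_x f x =
   \int[lebesgue_measure]_x (f x * (normal_pdf m s x)%:E))%E.
Proof.
move=> mf f0; have dom := normal_prob_dominates m s.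
rewrite -(Radon_Nikodym_SigmaFinite.change_of_variables dom)//.
pose g := Radon_Nikodym_SigmaFinite.f (normal_prob m s) lebesgue_measure.
have ig : lebesgue_measure.-integrable setT g
  by exact: Radon_Nikodym_SigmaFinite.f_integrable.
have mg := measurable_int _ ig.
have mpdf : measurable_fun setT (fun x : measurableTypeR R => (normal_pdf m s x)%:E).
  by apply/measurable_EFinP; exact: measurable_normal_pdf.
apply: ge0_ae_eq_integral => //.
- exact: emeasurable_funM.
- exact: emeasurable_funM.
- by move=> x _; rewrite mule_ge0//; exact: Radon_Nikodym_SigmaFinite.f_ge0.
- by move=> x _; rewrite mule_ge0// lee_fin normal_pdf_ge0.
have : ae_eq lebesgue_measure setT g (fun x => (normal_pdf m s x)%:E).
  apply: integral_ae_eq => // E _ mE.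
  by rewrite -Radon_Nikodym_SigmaFinite.f_integral.
by apply: filterS => x /(_ I) + _ => /= <-.
Qed.

(** Completing the square, the tilting factor turns the density of mean [m] into the density of mean
    [m + c], which has total mass 1. *)
Lemma integral_normal_tilt (R : realType) (m s c : R) : 0 < s ->
  (\int[normal_prob m s]_x
     (expR (c * (x - m) / s ^+ 2 - c ^+ 2 / (2 * s ^+ 2)))%:E = 1)%E.
Proof.
move=> s0; rewrite integral_normal_prob; last 2 first.
- apply/measurable_EFinP; apply: measurableT_comp => //.
  apply: measurable_funB => //; apply: measurable_funM => //.
  by apply: measurable_funM => //; exact: measurable_funB.
- by move=> x; rewrite lee_fin expR_ge0.
rewrite -[RHS](integral_normal_pdf (m + c) s); apply: eq_integral => x _.
rewrite -EFinM; congr EFin; rewrite !normal_pdfE ?gt_eqF// mulrCA; congr (_ * _).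
rewrite /normal_fun -expRD; congr expR; field.
by rewrite gt_eqF.
Qed.

(** * Product formula for integrals under independence *)

Section independence.
Context d (T : measurableType d) (R : realType) (P : probability T R).
Context (G : set (set T)) (Y : T -> R).
Hypotheses (mG : forall A, <<s G >> A -> measurable A)
  (mY : measurable_fun setT Y)
  (indep : forall A B, <<s G >> A -> measurable B ->
     P (A `&` Y @^-1` B) = (P A * P (Y @^-1` B))%E).

(** Typing [z] on [g_sigma_algebraType G] makes its measurability relative to [<<s G>>], which will
    be the history before a round, while [Y] is an outcome of that round. *)
Lemma integral_independent (z : g_sigma_algebraType G -> \bar R)
  (h : R -> \bar R) :
  measurable_fun setT z -> (forall w, 0 <= z w)%E ->
  measurable_fun setT h -> (forall y, 0 <= h y)%E ->
  (\int[P]_w (z w * h (Y w)) = \int[P]_w z w * \int[P]_w h (Y w))%E.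
Proof.
move=> mz z0 mh h0.
(* The pair (identity, Y) maps P to a product measure on (T, <<s G>>) x R. *)
pose TG : measurableType _ := g_sigma_algebraType G.
pose idG : T -> TG := id.
have midG : measurable_fun setT idG by move=> _ A mA; rewrite setTI; exact: mG.
pose phi : T -> (TG * R)%type := fun w => (idG w, Y w).
have mphi : measurable_fun setT phi by exact: measurable_fun_pair.
pose mphi' : {mfun T >-> (TG * R)%type} :=
  HB.pack phi (isMeasurableFun.Build _ _ _ _ _ mphi).
pose midG' : {mfun T >-> TG} := HB.pack idG (isMeasurableFun.Build _ _ _ _ _ midG).
pose Y' : {mfun T >-> R} := HB.pack Y (isMeasurableFun.Build _ _ _ _ _ mY).
pose f (u : TG * R) := (z u.1 * h u.2)%E.
have mf : measurable_fun setT f.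
  by apply: emeasurable_funM; apply: measurableT_comp.
have f0 u : (0 <= f u)%E by rewrite mule_ge0.
transitivity (\int[distribution P midG' \x distribution P Y']_u f u)%E.
  rewrite -[LHS](ge0_integral_distribution mphi' mf f0).
  apply: eq_measure_integral => /= A mA _; apply/esym.
  exact: product_measure_unique.
rewrite fubini_tonelli1// /fubini_F /f/=.
under eq_integral => x _.
  rewrite ge0_integralZl//. over.
rewrite ge0_integralZr//; last exact: integral_ge0.
by rewrite !ge0_integral_distribution.
Qed.

End independence.

(** * Independence of a variable from the sigma-algebra of others *)

(** A pi-system generating the sigma-algebra of the variables indexed by [L]. *)
Definition cylinder {T : Type} {R : realType} {J : eqType}
    (X : J -> T -> R) (L : seq J) : set (set T) :=
  [set A | exists2 B : J -> set R, (forall j, measurable (B j)) &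
    A = [set w | forall j, j \in L -> B j (X j w)]].

Section cylinder_independence.
Context d (T : measurableType d) (R : realType) (P : probability T R).
Context (J : eqType) (X : J -> T -> R).
Hypotheses (mX : forall j, measurable_fun setT (X j))
  (indep : mutually_independent P X).

Lemma cylinder_measurable (L : seq J) A : cylinder X L A -> measurable A.
Proof.
move=> [B mB ->]; elim: L => [|j L IH].
  by rewrite (_ : mkset _ = setT)//; apply/seteqP.
rewrite (_ : mkset _ = X j @^-1` B j `&` [set w | forall i, i \in L -> B i (X i w)]).
  by apply: measurableI => //; rewrite -[X in measurable X]setTI; exact: mX.
apply/seteqP; split=> w /=.
  move=> h; split; first by apply: h; rewrite mem_head.
  by move=> i iL; apply: h; rewrite inE iL orbT.
by move=> [h1 h2] i; rewrite inE => /predU1P[->|]//; exact: h2.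
Qed.

Lemma g_cylinder_measurable (L : seq J) A : <<s cylinder X L >> A -> measurable A.
Proof.
apply: smallest_sub; last exact: cylinder_measurable.
exact: sigma_algebra_measurable.
Qed.

Lemma cylinder_setI (L : seq J) : setI_closed (cylinder X L).
Proof.
move=> _ _ [B mB ->] [C mC ->]; exists (fun j => B j `&` C j).
  by move=> j; exact: measurableI.
apply/seteqP; split=> w /=; first by move=> [h1 h2] j jL; split; [exact: h1|exact: h2].
by move=> h; split=> j /h[].
Qed.

(** Pi-lambda argument: the events independent of a fixed event form a Dynkin system, so it is
    enough to treat the pi-system of cylinders. *)
Lemma cylinder_independent (L : seq J) (j0 : J) A B :
  uniq L -> j0 \notin L -> <<s cylinder X L >> A -> measurable B ->
  P (A `&` X j0 @^-1` B) = (P A * P (X j0 @^-1` B))%E.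
Proof.
move=> uL j0L sA mB; set E := X j0 @^-1` B.
have mE : measurable E by rewrite -[E]setTI; exact: mX.
suff : <<s cylinder X L >> `<=`
    [set A | measurable A /\ P (A `&` E) = (P A * P E)%E].
  by move=> /(_ _ sA)[].
rewrite -setI_closed_g_dynkin_g_sigma_algebra; last exact: cylinder_setI.
apply: smallest_sub; last first.
  move=> C CL; split; first exact: cylinder_measurable CL.
  case: CL => D mD ->.
  (* Placing [B] at [j0] makes the intersection with [E] a cylinder over [j0 :: L], so mutual
     independence applies to both lists; since [j0] is not in [L], the other factors are
     unchanged. *)
  pose D' j := if j == j0 then B else D j.
  have mD' j : measurable (D' j) by rewrite /D'; case: ifPn.
  have D'L j : j \in L -> D' j = D j.
    by move=> jL; rewrite /D'; case: eqP => // jj0; rewrite -jj0 jL in j0L.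
  have /= h1 := @indep (j0 :: L) D'.
  have /= h2 := @indep L D.
  rewrite h2//.
  have -> : [set w | forall j, j \in L -> D j (X j w)] `&` E =
     [set w | forall j, j \in j0 :: L -> D' j (X j w)].
    apply/seteqP; split=> w /=.
      move=> [h Ew] j; rewrite inE => /predU1P[->|jL]; last by rewrite D'L//; exact: h.
      by rewrite /D' eqxx.
    move=> h; split => [j jL|]; first by rewrite -(D'L _ jL); apply: h; rewrite inE jL orbT.
    by have := h j0; rewrite mem_head /D' eqxx; exact.
  rewrite h1 ?j0L//= big_cons muleC {2}/D' eqxx; congr (_ * _)%E.
  by rewrite big_seq [RHS]big_seq; apply: eq_bigr => j jL; rewrite D'L.
split.
- by split => //; rewrite setTI probability_setT mul1e.
- move=> C [mC hC]; split; first exact: measurableC.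
  have fE : P E \is a fin_num by exact: fin_num_measure.
  have fC : P C \is a fin_num by exact: fin_num_measure.
  rewrite setIC -setDE measureD//; last by rewrite ltey_eq fE.
  by rewrite probability_setC// setIC [X in (_ - X)%E]hC muleBl// ?mul1e// fin_num_adde_defr.
- move=> F tF hF; split; first by apply: bigcup_measurable => n _; case: (hF n).
  have mF n : measurable (F n) by case: (hF n).
  rewrite setI_bigcupl !measure_bigcup//; last 2 first.
  + by move=> n _; exact: measurableI.
  + by under eq_fun do rewrite setIC; exact: trivIset_setIl.
  have Ee : P E = (fine (P E))%:E by rewrite fineK// fin_num_measure.
  rewrite muleC Ee -nneseriesZl//; apply: eq_eseriesr => n _.
  by rewrite -Ee muleC; case: (hF n).
Qed.
End cylinder_independence.

(** * History, non-anticipation and the likelihood ratio *)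

Section bandit.
Context d (T : measurableType d) (R : realType) (K : nat) (P : probability T R).
Context (theta : 'rV[R]_K) (sigma : R).
Context (Y : nat -> 'I_K -> T -> R) (U : T -> R) (arm : nat -> T -> 'I_K).
Hypotheses (sigma_gt0 : 0 < sigma)
  (mY : forall t i, measurable_fun setT (Y t i))
  (lawY : forall t i B, measurable B ->
     P (Y t i @^-1` B) = normal_prob (theta 0 i) sigma B)
  (mU : measurable_fun setT U)
  (indepY : mutually_independent P (all_vars Y U))
  (na : non_anticipating Y arm U).

(** The internal randomization together with all potential outcomes of rounds before [t], observed
    or not: these determine the history. *)
Let past t : seq (option (nat * 'I_K)) :=
  None :: [seq Some x | x <- [seq (s, i) | s <- iota 0 t, i <- enum 'I_K]].

Let mvars o : measurable_fun setT (all_vars Y U o).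
Proof. by case: o => [[t i]|]; [exact: mY|exact: mU]. Qed.

Let mem_past t s i : (Some (s, i) \in past t) = (s < t)%N.
Proof.
rewrite inE/= mem_map; last by move=> x y [].
apply/allpairsP/idP => [[[s' i']]/= [+ _ [-> _]]|st]; first by rewrite mem_iota.
by exists (s, i); rewrite mem_iota mem_enum.
Qed.

Let uniq_past t : uniq (past t).
Proof.
rewrite cons_uniq; apply/andP; split; first by apply/mapP => -[].
rewrite map_inj_uniq; last by move=> x y [].
by apply: allpairs_uniq; rewrite ?iota_uniq ?enum_uniq// => -[? ?] [? ?].
Qed.

Let cyl t := cylinder (all_vars Y U) (past t).

Let coord_cyl t o B : o \in past t -> measurable B ->
  <<s cyl t >> (all_vars Y U o @^-1` B).
Proof.
move=> ot mB; apply: sub_gen_smallest.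
exists (fun j => if j == o then B else setT); first by move=> j; case: ifP.
apply/seteqP; split=> w /=; first by move=> Bw j _; case: eqP => // ->.
by move=> /(_ _ ot); rewrite eqxx.
Qed.

Let cyl_mono t t' : (t <= t')%N -> <<s cyl t >> `<=` <<s cyl t' >>.
Proof.
move=> tt'; apply: smallest_sub; first exact: smallest_sigma_algebra.
move=> A [B mB ->]; apply: sub_gen_smallest.
exists (fun j => if j \in past t then B j else setT); first by move=> j; case: ifP.
apply/seteqP; split=> w /= h j; first by move=> _; case: ifPn => // /h.
move=> jt; have := h j; rewrite jt; apply.
case: j jt {h} => [[s i]|//]; rewrite !mem_past => /leq_trans; exact.
Qed.

(** An observed outcome is split by the chosen arm [i]: on that part it equals [Y s i], a past
    variable, and the choice of [i] at round [s] lies in the history before [s] by non-anticipation,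
    so strong induction applies. *)
Lemma history_cyl t : <<s history_gen Y arm U t >> `<=` <<s cyl t >>.
Proof.
elim/ltn_ind: t => t IH; apply: smallest_sub; first exact: smallest_sigma_algebra.
have arm_cyl s i : (s < t)%N -> <<s cyl t >> (arm s @^-1` [set i]).
  by move=> st; apply: (@cyl_mono s t (ltnW st)); apply: IH => //; exact: na.
move=> A [[s [B [st [mB ->]]]]|[[s [i [st ->]]]|[B [mB ->]]]].
- rewrite (_ : _ @^-1` _ = \bigcup_(i in [set: 'I_K]) (arm s @^-1` [set i] `&` Y s i @^-1` B)).
    apply: (@fin_bigcup_measurable _ (g_sigma_algebraType (cyl t))) => // i _.
    apply: measurableI; first exact: arm_cyl.
    by apply: (@coord_cyl t (Some (s, i))) => //; rewrite mem_past.
  apply/seteqP; split=> w /=; first by move=> Bw; exists (arm s w).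
  by move=> [i _ [/= + ?]]; rewrite /observed => ->.
- exact: arm_cyl.
- by apply: (@coord_cyl t None) => //; rewrite mem_head.
Qed.

Lemma history_measurable t A : <<s history_gen Y arm U t >> A -> measurable A.
Proof. by move=> /history_cyl/g_cylinder_measurable; exact. Qed.

Lemma arm_measurable t i : measurable (arm t @^-1` [set i]).
Proof. exact: history_measurable (na t i). Qed.

Lemma history_independent t i A B :
  <<s history_gen Y arm U t >> A -> measurable B ->
  P (A `&` Y t i @^-1` B) = (P A * P (Y t i @^-1` B))%E.
Proof.
move=> /history_cyl hA mB.
apply: (@cylinder_independent _ _ _ P _ _ mvars indepY (past t) (Some (t, i))) => //.
by rewrite mem_past ltnn.
Qed.

Variable c : 'I_K -> R.

(** Log-density ratio of the normal law with mean [theta 0 i + c i] against that with mean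
    [theta 0 i], both of variance [sigma ^+ 2]. *)
Definition log_ratio (i : 'I_K) (y : R) : R :=
  c i * (y - theta 0 i) / sigma ^+ 2 - c i ^+ 2 / (2 * sigma ^+ 2).

Definition likelihood_ratio (t : nat) (w : T) : R :=
  expR (\sum_(s < t) log_ratio (arm s w) (observed Y arm s w)).

Let mlog_ratio i : measurable_fun setT (log_ratio i).
Proof.
apply: measurable_funB => //; apply: measurable_funM => //.
by apply: measurable_funM => //; exact: measurable_funB.
Qed.

Lemma integral_log_ratio t i :
  (\int[P]_w (expR (log_ratio i (Y t i w)))%:E = 1)%E.
Proof.
pose X : {mfun T >-> R} := HB.pack (Y t i) (isMeasurableFun.Build _ _ _ _ _ (mY t i)).
pose h y := (expR (log_ratio i y))%:E : \bar R.
have mh : measurable_fun setT h.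
  by apply/measurable_EFinP; exact: measurableT_comp.
have h0 y : (0 <= h y)%E by rewrite lee_fin expR_ge0.
have mid : measurable_fun setT (idfun : measurableTypeR R -> R).
  by move=> _ B mB; rewrite setTI.
rewrite -[LHS](ge0_integral_distribution X mh h0).
rewrite -(@integral_normal_tilt R (theta 0 i) sigma (c i) sigma_gt0).
(* [normal_prob] is a measure on [measurableTypeR R], whose display is not the
   one of [R]: transport it along the identity. *)
transitivity (\int[pushforward (normal_prob (theta 0 i)%R sigma)
    (idfun : measurableTypeR R -> R)]_y h y)%E.
  by apply: eq_measure_integral => /= A mA _; rewrite /distribution /pushforward lawY.
by rewrite ge0_integral_pushforward.
Qed.

Let mlikelihood_ratio t :
  measurable_fun setT (likelihood_ratio t : g_sigma_algebraType (history_gen Y arm U t) -> R).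
Proof.
apply: measurableT_comp => //; apply: measurable_sum => -[s st].
(* The random index [arm s w] is traded for a finite sum of indicators, whose terms are measurable
   for the history. *)
rewrite (_ : (fun w => _) = (fun w : g_sigma_algebraType (history_gen Y arm U t) =>
   \sum_i (\1_(arm s @^-1` [set i]) w * log_ratio i (observed Y arm s w)))).
  apply: measurable_sum => i; apply: measurable_funM.
    apply: measurable_indic; apply: sub_gen_smallest.
    by right; left; exists s, i.
  apply: measurableT_comp => //.
  move=> _ B mB; rewrite setTI; apply: sub_gen_smallest.
  by left; exists s, B.
apply/funext => w; rewrite (bigD1 (arm s w))//= big1 ?addr0.
  by rewrite indicE mem_set// mul1r.
by move=> i ii; rewrite indicE memNset ?mul0r// => /= h; rewrite h eqxx in ii.
Qed.

Lemma likelihood_ratio_measurable t : measurable_fun setT (likelihood_ratio t).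
Proof.
move=> _ B mB; rewrite setTI; apply: (@history_measurable t).
by rewrite -[_ @^-1` _]setTI; exact: mlikelihood_ratio.
Qed.

(** Martingale argument: the arm of round [t] is determined by the history, and the outcomes of that
    round are independent of it, so each new factor has conditional mean 1. *)
Lemma integral_likelihood_ratio t :
  (\int[P]_w (likelihood_ratio t w)%:E = 1)%E.
Proof.
elim: t => [|t IH].
  under eq_integral do rewrite /likelihood_ratio big_ord0 expR0.
  by rewrite integral_cst//= mul1e; exact: probability_setT.
(* [z i] is the past ratio restricted to the choice of arm [i], hence history-measurable; the new
   factor then involves the single outcome [Y t i]. *)
pose z i w := (likelihood_ratio t w * \1_(arm t @^-1` [set i]) w)%:E.
pose h i y := (expR (log_ratio i y))%:E : \bar R.
have z0 i w : (0 <= z i w)%E by rewrite lee_fin mulr_ge0// expR_ge0.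
have h0 i y : (0 <= h i y)%E by rewrite lee_fin expR_ge0.
have mz i : measurable_fun setT (z i : g_sigma_algebraType (history_gen Y arm U t) -> _).
  apply/measurable_EFinP; apply: measurable_funM => //.
  by apply: measurable_indic; exact: na.
have mzT i : measurable_fun setT (z i).
  apply/measurable_EFinP; apply: measurable_funM => //.
    exact: likelihood_ratio_measurable.
  by apply: measurable_indic; exact: arm_measurable.
have mh i : measurable_fun setT (h i).
  by apply/measurable_EFinP; exact: measurableT_comp.
transitivity (\int[P]_w \sum_(i < K) (z i w * h i (Y t i w)))%E.
  apply: eq_integral => w _.
  rewrite (bigD1 (arm t w))//= big1 ?adde0.
    rewrite /z indicE mem_set// mulr1 -EFinM /likelihood_ratio big_ord_recr/= expRD.
    by [].
  move=> i ii; rewrite /z indicE memNset ?mulr0 ?mul0e// => /= e.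
  by rewrite e eqxx in ii.
rewrite ge0_integral_sum//; last 2 first.
- move=> i; apply: emeasurable_funM => //; exact: measurableT_comp.
- by move=> i w _; rewrite mule_ge0.
under eq_bigr => i _.
  rewrite (@integral_independent _ _ _ P (history_gen Y arm U t) (Y t i) _ _ _ (z i) (h i))//; last 2 first.
  - exact: history_measurable.
  - exact: history_independent.
  rewrite integral_log_ratio mule1. over.
rewrite -ge0_integral_sum// -IH; apply: eq_integral => w _.
rewrite (bigD1 (arm t w))//= big1 ?adde0.
  by rewrite /z indicE mem_set// mulr1.
move=> i ii; rewrite /z indicE memNset ?mulr0// => /= e.
by rewrite e eqxx in ii.
Qed.

Lemma likelihood_ratio_chernoff t (A : set T) (x : R) : measurable A ->
  (forall w, A w -> expR x <= likelihood_ratio t w) ->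
  (P A <= (expR (- x))%:E)%E.
Proof.
move=> mA hA.
have : ((expR x)%:E * P A <= 1)%E.
  rewrite -(integral_likelihood_ratio t) -integral_cst//.
  apply: (@le_trans _ _ (\int[P]_(w in A) (likelihood_ratio t w)%:E)%E).
    apply: ge0_le_integral => //.
    - by move=> w _; rewrite lee_fin expR_ge0.
    - by apply/measurable_EFinP; apply: measurable_funTS; exact: likelihood_ratio_measurable.
  apply: ge0_subset_integral => //.
    by apply/measurable_EFinP; exact: likelihood_ratio_measurable.
  by move=> w _; rewrite lee_fin expR_ge0.
rewrite expRN -lee_pdivlMl ?expR_gt0//.
by rewrite mule1.
Qed.

End bandit.

(** * Projection onto the alternative set and closed sublevel sets *)

Section projection.
Context (R : realType) (K : nat) (theta : 'rV[R]_K) (sigma : R)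
  (istar : 'I_K) (J : {set 'I_K}).
Hypothesis sigma_gt0 : 0 < sigma.

Let M := [set l : 'rV[R]_K | forall i, i \in J -> l 0 istar <= l 0 i].

Definition divergence (p l : 'rV[R]_K) : R :=
  \sum_(i < K) p 0 i * (l 0 i - theta 0 i) ^+ 2 / (2 * sigma ^+ 2).

Let bnd : R := \sum_i `|theta 0 i|.

(** [bnd] dominates every coordinate of [theta] in absolute value, so for nonnegative weights this
    compact part of [M] still contains a minimizer of the divergence. *)
Definition box : set 'rV[R]_K :=
  [set l | M l /\ forall i, l 0 i \in `[- bnd, bnd]].

Lemma le_coord_closed (i j : 'I_K) : closed [set l : 'rV[R]_K | l 0 i <= l 0 j].
Proof.
rewrite (_ : mkset _ = (fun l : 'rV[R]_K => l 0 i - l 0 j) @^-1` [set x | x <= 0]).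
  apply: closed_comp; last exact: closed_le.
  by move=> l _; apply: continuousB; exact: coord_continuous.
by apply/seteqP; split=> l /=; rewrite subr_le0.
Qed.

Lemma alt_closed : closed M.
Proof.
rewrite (_ : M = \bigcap_(i in [set i | i \in J]) [set l | l 0 istar <= l 0 i]).
  by apply: closed_bigI => i _; exact: le_coord_closed.
by apply/seteqP; split=> l.
Qed.

Lemma box_compact : compact box.
Proof.
rewrite (_ : box = [set l : 'rV[R]_K | forall i, `[- bnd, bnd]%classic (l ord0 i)] `&` M).
  apply: compact_closedI; last exact: alt_closed.
  apply: (@rV_compact R K (fun=> `[- bnd, bnd]%classic)) => _.
  exact: segment_compact.
by apply/seteqP; split=> l [? ?]; split.
Qed.

Lemma bnd_ge i : `|theta 0 i| <= bnd.
Proof. by rewrite /bnd (bigD1 i)//= lerDl sumr_ge0. Qed.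

Lemma box_nonempty : box !=set0.
Proof.
exists 0; split => [i _|i]; rewrite !mxE// in_itv/=.
have := bnd_ge i; have := normr_ge0 (theta 0 i); lra.
Qed.

Lemma divergence_continuous p : continuous (divergence p).
Proof.
apply: continuous_big; first exact: add_continuous.
move=> i _ l.
apply: (@continuousM R _ (fun l : 'rV[R]_K => p 0 i * (l 0 i - theta 0 i) ^+ 2)
  (fun=> (2 * sigma ^+ 2)^-1)); last exact: cst_continuous.
apply: (@continuousM R _ (fun=> p 0 i) (fun l : 'rV[R]_K => (l 0 i - theta 0 i) ^+ 2)).
  exact: cst_continuous.
apply: (@continuous_comp _ _ _ (fun l : 'rV[R]_K => l 0 i - theta 0 i) (fun x => x ^+ 2)).
  by apply: continuousB; [exact: coord_continuous|exact: cst_continuous].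
exact: exprn_continuous.
Qed.

Lemma divergence_box_min p :
  exists2 l, box l & forall l', box l' -> divergence p l <= divergence p l'.
Proof.
have [//|l] := @compact_EVT_min _ _ (divergence p) _ box_nonempty box_compact.
  by apply: continuous_subspaceT; exact: divergence_continuous.
by rewrite inE => bl hl; exists l => // l' bl'; apply: hl; rewrite inE.
Qed.

(* Clipping to an interval containing every coordinate of theta is monotone
   and brings each coordinate closer to theta. *)
Lemma divergence_clip (p l : 'rV[R]_K) : (forall i, 0 <= p 0 i) -> M l ->
  exists2 l', box l' & divergence p l' <= divergence p l.
Proof.
move=> p0 Ml; pose clip (x : R) := Num.max (- bnd) (Num.min bnd x).
have bnd0 : 0 <= bnd by exact: sumr_ge0.
exists (\row_i clip (l 0 i)).
  split=> [i iJ|i]; rewrite !mxE.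
    by apply: le_max2 => //; apply: le_min2 => //; exact: Ml.
  by rewrite in_itv/= /clip le_max lexx/= ge_max ge_min lexx/= andbT; lra.
apply: ler_sum => i _; rewrite ler_pM2r ?invr_gt0 ?mulr_gt0 ?exprn_gt0//.
rewrite ler_wpM2l// mxE; set x := l 0 i.
have : - bnd <= theta 0 i <= bnd by rewrite -ler_norml bnd_ge.
move=> /andP[h1 h2]; rewrite -ler_sqrt ?sqr_ge0// !sqrtr_sqr.
rewrite /clip; case: (leP bnd x) => h3.
  have -> : Num.max (- bnd) bnd = bnd by apply/max_idPr; lra.
  by rewrite !ger0_norm; lra.
case: (leP (- bnd) x) => h4 //.
by rewrite !ler0_norm; lra.
Qed.

Lemma divergence_min (p : 'rV[R]_K) : (forall i, 0 <= p 0 i) ->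
  exists2 l, box l & forall l', M l' -> divergence p l <= divergence p l'.
Proof.
move=> p0; have [l bl hl] := divergence_box_min p; exists l => // l' Ml'.
by have [l'' /hl h1 h2] := divergence_clip p l' p0 Ml'; exact: le_trans h1 h2.
Qed.

Lemma divergence_expand (p l m : 'rV[R]_K) (s : R) :
  divergence p (l + s *: (m - l)) * (2 * sigma ^+ 2) =
  divergence p l * (2 * sigma ^+ 2) +
  s * (2 * \sum_i p 0 i * (l 0 i - theta 0 i) * (m 0 i - l 0 i) +
       s * \sum_i p 0 i * (m 0 i - l 0 i) ^+ 2).
Proof.
rewrite /divergence !mulr_suml !mulr_sumr -big_split/= mulr_sumr -big_split/=.
apply: eq_bigr => i _; rewrite !mxE; field.
by rewrite gt_eqF.
Qed.

(* First-order optimality of the projection onto the convex set M. *)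
Lemma divergence_min_variational (p l m : 'rV[R]_K) : (forall i, 0 <= p 0 i) -> M l ->
  (forall l', M l' -> divergence p l <= divergence p l') -> M m ->
  0 <= \sum_i p 0 i * (l 0 i - theta 0 i) * (m 0 i - l 0 i).
Proof.
move=> p0 Ml hl Mm; set D := \sum_i _; rewrite leNgt; apply/negP => D0.
set Q := \sum_i p 0 i * (m 0 i - l 0 i) ^+ 2.
have Q0 : 0 <= Q by apply: sumr_ge0 => i _; rewrite mulr_ge0// sqr_ge0.
(* The bound 1 keeps the point on the segment from [l] to [m]; the other gives [s * Q <= - D], so
   the increment is at most [s * D < 0]. The [+ 1] avoids division by zero. *)
pose s := Num.min 1 (- D / (Q + 1)).
have s0 : 0 < s by rewrite /s lt_min ltr01/= divr_gt0//; lra.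
have s1 : s <= 1 by rewrite /s ge_min lexx.
have sQ : s * Q <= - D.
  apply: (@le_trans _ _ (- D / (Q + 1) * Q)).
    by rewrite ler_wpM2r// /s ge_min lexx orbT.
  by rewrite -mulrA ler_piMr; [|lra|rewrite mulrC ler_pdivrMr; lra].
have : M (l + s *: (m - l)).
  move=> i iJ; rewrite !mxE; have := Ml i iJ; have := Mm i iJ => h1 h2; nra.
move=> /hl; rewrite -(@ler_pM2r _ (2 * sigma ^+ 2)) ?mulr_gt0 ?exprn_gt0//.
rewrite divergence_expand -/D -/Q lerDl pmulr_rge0//; lra.
Qed.

(** The right side is the log-likelihood ratio per round for the shift [l - theta]; it exceeds the
    left by the first-order term divided by [sigma ^+ 2]. *)
Lemma divergence_min_linear (p l m : 'rV[R]_K) : (forall i, 0 <= p 0 i) -> M l ->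
  (forall l', M l' -> divergence p l <= divergence p l') -> M m ->
  divergence p l <= \sum_i p 0 i * ((l 0 i - theta 0 i) * (m 0 i - theta 0 i) / sigma ^+ 2
    - (l 0 i - theta 0 i) ^+ 2 / (2 * sigma ^+ 2)).
Proof.
move=> p0 Ml hl Mm; have := divergence_min_variational p l m p0 Ml hl Mm.
rewrite -subr_ge0 => h; rewrite -subr_ge0.
rewrite [leRHS](_ : _ = (\sum_i p 0 i * (l 0 i - theta 0 i) * (m 0 i - l 0 i)) / sigma ^+ 2).
  by rewrite divr_ge0 ?sqr_ge0//; rewrite subr0 in h.
rewrite /divergence mulr_suml -sumrB; apply: eq_bigr => i _; field.
by rewrite gt_eqF.
Qed.

(** For nonnegative [p] this is the condition F(p) <= a, phrased through the compact box to obtain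
    closedness. *)
Definition sublevel (a : R) : set 'rV[R]_K :=
  [set p | exists2 l, box l & divergence p l <= a].

(** On the box the divergence is Lipschitz in [p] uniformly in [l], so a minimum above [a] stays
    above [a] near [p]. *)
Lemma sublevel_closed a : closed (sublevel a).
Proof.
rewrite -openC openE => p /= hp; rewrite /interior.
have [l bl hl] := divergence_box_min p.
have al : a < divergence p l by rewrite ltNge; apply/negP => h; apply: hp; exists l.
set e := divergence p l - a.
(* Both [l 0 i] and [theta 0 i] lie within [bnd] of 0, so [C] bounds every coefficient of [p]; the
   [+ 1] keeps it positive when [bnd] is 0. *)
pose C := (2 * bnd) ^+ 2 / (2 * sigma ^+ 2) + 1.
have C0 : 0 < C by rewrite ltr_pwDr// divr_ge0 ?sqr_ge0// mulr_ge0// sqr_ge0.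
pose dist (q : 'rV[R]_K) := \sum_i `|q 0 i - p 0 i|.
have cdist : dist q @[q --> p] --> (0 : R).
  rewrite [X in _ --> X](_ : _ = dist p); last first.
    by rewrite /dist big1// => i _; rewrite subrr normr0.
  suff : continuous dist by exact.
  apply: continuous_big; first exact: add_continuous.
  move=> i _ q; apply: (@continuous_comp _ _ _ (fun l : 'rV[R]_K => l 0 i - p 0 i) Num.norm).
    by apply: continuousB; [exact: coord_continuous|exact: cst_continuous].
  exact: norm_continuous.
have e0 : 0 < e / C by rewrite divr_gt0// subr_gt0.
have : \forall q \near p, dist q < e / C by exact: (@cvgr_lt R _ (nbhs p) _ dist 0 cdist).
apply: filterS => q; rewrite ltr_pdivlMr// => hq [l' bl' hl'].
have h1 : divergence p l' - divergence q l' <= dist q * C.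
  rewrite /divergence -sumrB mulr_suml; apply: ler_sum => i _.
  rewrite -mulrBl -mulrBl distrC -mulrA; apply: (le_trans (ler_norm _)).
  rewrite normrM ler_wpM2l// ger0_norm; last first.
    by rewrite divr_ge0 ?sqr_ge0// mulr_ge0// sqr_ge0.
  apply: (@le_trans _ _ ((2 * bnd) ^+ 2 / (2 * sigma ^+ 2))); last by rewrite lerDl.
  rewrite ler_pM2r ?invr_gt0 ?mulr_gt0 ?exprn_gt0//.
  have := bl'.2 i; rewrite in_itv/= => /andP[b1 b2].
  have : - bnd <= theta 0 i <= bnd by rewrite -ler_norml bnd_ge.
  move=> /andP[h1 h2]; rewrite -ler_sqrt ?sqr_ge0// !sqrtr_sqr.
  rewrite [leRHS]ger0_norm; last lra.
  by rewrite ler_norml; lra.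
have := hl _ bl'; rewrite /e in hq; lra.
Qed.

Lemma Frate_sublevel p a : sublevel a p -> (Frate sigma theta M p <= a%:E)%E.
Proof.
move=> [l [Ml _] la]; apply: (@le_trans _ _ (divergence p l)%:E); last by rewrite lee_fin.
by apply: ereal_inf_lbound; exists l => //; exact: subset_closure.
Qed.

End projection.

(** * Exponential rates and subexponential factors *)

Lemma natr_expn_le_expR (R : realType) (K : nat) (e : R) : 0 < e ->
  \forall t \near \oo, 1 + t.+1%:R ^+ K <= expR (t%:R * e) :> R.
Proof.
(* With [t.+1%:R <= expR (t%:R * eta)], the [K.+1] factors of [t.+1%:R ^+ K.+1] share the exponent
   [t%:R * e]; the extra factor absorbs the summand 1. *)
move=> e0; pose eta := e / K.+1%:R.
have eta0 : 0 < eta by rewrite divr_gt0.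
near=> t.
have t1 : 1 <= t%:R :> R by near: t; exact: nbhs_infty_ger.
(* From this threshold on, the quadratic term of the exponential is at least [2 * t%:R]. *)
have t4 : 4 / eta ^+ 2 <= t%:R by near: t; exact: nbhs_infty_ger.
have h1 : t.+1%:R <= expR (t%:R * eta).
  apply: (@le_trans _ _ (1 + (t%:R * eta) ^+ 2 / 2)); last first.
    have := @expR_ge1Dxn R (t%:R * eta) 1; apply.
    by rewrite mulr_ge0// ltW.
  have : 4 <= t%:R * eta ^+ 2 by rewrite -ler_pdivrMr// exprn_gt0.
  move=> /(ler_wpM2l (ler0n R t)); rewrite [(t%:R * _) ^+ 2]exprMn -[t.+1%:R]natr1 => h; lra.
apply: (@le_trans _ _ (t.+1%:R ^+ K.+1)).
  have : 1 <= t.+1%:R ^+ K :> R by apply: exprn_ege1; rewrite ler1n.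
  rewrite exprS -[in X in _ -> _ <= X * _]natr1; set x := _ ^+ K => h; nra.
apply: (@le_trans _ _ (expR (t%:R * eta) ^+ K.+1)).
  by apply: lerXn2r => //; rewrite nnegrE ?expR_ge0.
by rewrite -expRM_natl ler_expR mulrCA ler_wpM2l// /eta mulrC divfK.
Unshelve. all: by end_near. Qed.

Lemma eln_le (R : realType) (x y : R) : 0 <= x -> x <= expR y -> (eln x <= y%:E)%E.
Proof.
move=> x0 xy; rewrite /eln; case: eqVneq => [_|xn0]; first exact: leNye.
by rewrite lee_fin -[leRHS]expRK ler_ln// posrE ?expR_gt0// lt_neqAle eq_sym xn0.
Qed.

Lemma le_expR_eln (R : realType) (x y : R) : 0 <= x -> (eln x <= y%:E)%E -> x <= expR y.
Proof.
move=> x0; rewrite /eln; case: eqVneq => [->|xn0]; first by rewrite expR_ge0.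
have xp : 0 < x by rewrite lt_neqAle eq_sym xn0.
by rewrite lee_fin => h; rewrite -[leLHS]lnK ?posrE// ler_expR.
Qed.

(** A sum decays at the slower of its two rates, and both are at least [a] here, the polynomial
    factor costing nothing in the limit. *)
Lemma limn_einf_eln_ge (R : realType) (K : nat) (u v : nat -> R) (a : R) :
  (forall t, 0 <= u t) -> (forall t, 0 <= v t) ->
  (forall t, (0 < t)%N -> v t <= u t + t.+1%:R ^+ K * expR (- (t%:R * a))) ->
  (limn_esup (fun t => (t%:R^-1)%:E * eln (u t)) <= (- a)%:E ->
   a%:E <= limn_einf (fun t => - (t%:R^-1)%:E * eln (v t)))%E.
Proof.
move=> u0 v0 uv; rewrite /limn_einf /limn_esup !limf_esupE => hu.
apply/lee_subgt0Pr => e e0.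
have [_ [V Voo <-] hV] : exists2 y, [set ereal_sup
    [set (t%:R^-1)%:E * eln (u t) | t in V] | V in \oo]%E y & (y < (- a + e / 2)%:E)%E.
  by apply: ereal_inf_lt; apply: le_lt_trans hu _; rewrite lte_fin ltrDl divr_gt0.
(* The slack [e] is split evenly: one half bounds [u] on [V], the other absorbs the factor
   [1 + t.+1%:R ^+ K]. *)
rewrite leeNr; pose W := V `&` [set t | (0 < t)%N /\
  1 + t.+1%:R ^+ K <= expR (t%:R * (e / 2)) :> R].
apply: (@le_trans _ _ (ereal_sup [set (- (- (t%:R^-1)%:E * eln (v t)))%E | t in W])).
  apply: ereal_inf_lbound; exists W => //; apply: filterI => //.
  have h1 : \forall t \near \oo, (0 < t)%N by exact: nbhs_infty_gt.
  have h2 := @natr_expn_le_expR R K (e / 2) (divr_gt0 e0 (ltr0n _ 2)).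
  near=> t; split; near: t => //.
apply: ge_ereal_sup => _ [t [Vt [t0 ht]] <-].
have tp : 0 < t%:R :> R by rewrite ltr0n.
have ut : u t <= expR (t%:R * (- a + e / 2)).
  apply: le_expR_eln => //.
  rewrite EFinM -lee_pdivrMl//.
  by apply: ltW; apply: le_lt_trans hV; apply: ereal_sup_ubound; exists t.
have vt : v t <= expR (t%:R * (- a + e)).
  apply: le_trans (uv t t0) _.
  apply: (@le_trans _ _ (expR (t%:R * (- a + e / 2)) * (1 + t.+1%:R ^+ K))).
    rewrite mulrDr mulr1 lerD// mulrC ler_wpM2r ?exprn_ge0// ler_expR.
    by rewrite -mulrN ler_pM2l// lerDl ltW// divr_gt0.
  apply: (@le_trans _ _ (expR (t%:R * (- a + e / 2)) * expR (t%:R * (e / 2)))).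
    by rewrite ler_wpM2l// expR_ge0.
  by rewrite -expRD ler_expR -mulrDr -addrA -splitr.
rewrite mulNe oppeK lee_pdivrMl// -EFinB -EFinN -EFinM opprB addrC.
exact: eln_le.
Unshelve. all: by end_near. Qed.

Lemma measure_finite_union_le d (T : measurableType d) (R : realType)
  (P : probability T R) (F : finType) (E : F -> set T) (b : \bar R) :
  (forall x, measurable (E x)) -> (forall x, P (E x) <= b)%E ->
  (P (\bigcup_x E x) <= #|F|%:R%:E * b)%E.
Proof.
move=> mE hb; rewrite (_ : \bigcup_x E x = \big[setU/set0]_(x : F) E x); last first.
  apply/seteqP; split=> w.
    by move=> [x _ Ex]; rewrite (bigD1 x)//=; left.
  by elim/big_ind: _ => [//|A B hA hB [/hA|/hB]//|x _ Ex]; exists x.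
rewrite cardE /index_enum -enumT; elim: (enum F) => [|x s IH].
  by rewrite big_nil measure0 mul0e.
rewrite big_cons /= -natr1 addrC EFinD ge0_muleDl ?lee_fin// mul1e.
apply: le_trans (leeD (hb x) IH); apply: measureU2 => //.
by apply: bigsetU_measurable => ? _.
Qed.

(** * Deviation bound by a union over count vectors *)

Section bandit_bound.
Context d (T : measurableType d) (R : realType) (K : nat) (P : probability T R).
Context (theta : 'rV[R]_K) (sigma : R) (istar : 'I_K) (J : {set 'I_K}).
Context (Y : nat -> 'I_K -> T -> R) (U : T -> R) (arm : nat -> T -> 'I_K).
Hypotheses (sigma_gt0 : 0 < sigma)
  (mY : forall t i, measurable_fun setT (Y t i))
  (lawY : forall t i B, measurable B ->
     P (Y t i @^-1` B) = normal_prob (theta 0 i) sigma B)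
  (mU : measurable_fun setT U)
  (indepY : mutually_independent P (all_vars Y U))
  (na : non_anticipating Y arm U).

Let M := [set l : 'rV[R]_K | forall i, i \in J -> l 0 istar <= l 0 i].

Lemma Ncount_le t i w : (Ncount arm t i w <= t)%N.
Proof.
apply: (@leq_trans (\sum_(s < t) 1)); first by apply: leq_sum => s _; case: eqP.
by rewrite sum1_card card_ord.
Qed.

Lemma NcountE t i w : (Ncount arm t i w)%:R = \sum_(s < t | arm s w == i) 1 :> R.
Proof. by rewrite /Ncount natr_sum [RHS]big_mkcond; apply: eq_bigr => s _; case: eqP. Qed.

(** For an arm never chosen both sides vanish: the count is 0 and the sum is empty. *)
Lemma Ncount_m_emp t i w :
  (Ncount arm t i w)%:R * m_emp Y arm t w 0 i = \sum_(s < t | arm s w == i) Y s i w.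
Proof.
rewrite mxE mulrC; have [N0|N0] := eqVneq (Ncount arm t i w) 0%N; last first.
  by rewrite divfK// pnatr_eq0.
rewrite N0 mulr0 big_pred0// => s; apply/negbTE/eqP => si.
by move: N0; rewrite /Ncount (bigD1 s)//= si eqxx.
Qed.

(** Grouping the rounds by arm shows that counts and empirical means are sufficient statistics for
    the likelihood ratio. *)
Lemma sum_log_ratio (c : 'I_K -> R) t w :
  \sum_(s < t) log_ratio R K theta sigma c (arm s w) (observed Y arm s w) =
  \sum_i (Ncount arm t i w)%:R *
    (c i * (m_emp Y arm t w 0 i - theta 0 i) / sigma ^+ 2 - c i ^+ 2 / (2 * sigma ^+ 2)).
Proof.
rewrite (partition_big (fun s : 'I_t => arm s w) xpredT)//=; apply: eq_bigr => i _.
transitivity (c i / sigma ^+ 2 * (\sum_(s < t | arm s w == i) Y s i w)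
   + (- (c i * theta 0 i / sigma ^+ 2) - c i ^+ 2 / (2 * sigma ^+ 2)) *
     \sum_(s < t | arm s w == i) 1).
  rewrite !mulr_sumr -big_split/=; apply: eq_bigr => s /eqP si.
  rewrite /log_ratio /observed si; field.
  by rewrite gt_eqF.
rewrite -Ncount_m_emp -NcountE; field.
by rewrite gt_eqF.
Qed.

Let marm := arm_measurable d T R K Y U arm mY mU na.

Let marm_ind s i : measurable_fun setT (\1_(arm s @^-1` [set i]) : T -> R).
Proof. by apply: measurable_indic; exact: marm. Qed.

Let indic_arm s i w : \1_(arm s @^-1` [set i]) w = (arm s w == i)%:R :> R.
Proof.
rewrite indicE; congr (_ %:R); congr nat_of_bool.
by apply/idP/eqP; rewrite inE.
Qed.

Lemma Ncount_measurable t i (k : nat) : measurable [set w | Ncount arm t i w = k].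
Proof.
rewrite (_ : mkset _ = (fun w => \sum_(s < t) \1_(arm s @^-1` [set i]) w) @^-1` [set k%:R : R]).
  rewrite -[_ @^-1` _]setTI; apply: measurable_sum => //; exact: measurable_set1.
apply/seteqP; split=> w /=.
  move=> <-; rewrite /Ncount natr_sum; apply: eq_bigr => s _; exact: indic_arm.
under eq_bigr do rewrite indic_arm.
by rewrite -natr_sum => /eqP; rewrite eqr_nat => /eqP.
Qed.

Lemma reward_sum_measurable t i :
  measurable_fun setT (fun w => \sum_(s < t | arm s w == i) Y s i w).
Proof.
rewrite (_ : (fun w => _) = (fun w => \sum_(s < t) \1_(arm s @^-1` [set i]) w * Y s i w)).
  by apply: measurable_sum => s; exact: measurable_funM.
apply/funext => w; rewrite big_mkcond; apply: eq_bigr => s _.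
by rewrite indic_arm; case: eqP => _; rewrite ?mul1r ?mul0r.
Qed.

(** Counts up to [t] are encoded in ['I_t.+1], so the vectors form a finite type of cardinality
    [t.+1 ^ K]. *)
Definition counts (t : nat) (nu : {ffun 'I_K -> 'I_t.+1}) : set T :=
  [set w | forall i, Ncount arm t i w = nu i].

Definition freq (t : nat) (nu : {ffun 'I_K -> 'I_t.+1}) : 'rV[R]_K :=
  \row_i ((nu i)%:R / t%:R).

Lemma counts_measurable t nu : measurable (counts t nu).
Proof.
rewrite (_ : counts t nu = \bigcap_(i in [set: 'I_K]) [set w | Ncount arm t i w = nu i]).
  by apply: fin_bigcap_measurable => // i _; exact: Ncount_measurable.
by apply/seteqP; split=> w h => [i _|i]; exact: h.
Qed.

Lemma counts_p_emp t nu w : counts t nu w -> p_emp arm t w = freq t nu.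
Proof. by move=> h; apply/rowP => i; rewrite !mxE h. Qed.

Lemma counts_cover t w : exists nu, counts t nu w.
Proof.
exists [ffun i => inord (Ncount arm t i w)] => i.
by rewrite ffunE inordK// ltnS Ncount_le.
Qed.

Lemma alt_counts_measurable t nu :
  measurable ([set w | M (m_emp Y arm t w)] `&` counts t nu).
Proof.
(* On [counts t nu] the random denominators of the empirical means become the constants [nu i]. *)
pose S i w := (\sum_(s < t | arm s w == i) Y s i w) / (nu i)%:R.
have mS i : measurable_fun setT (S i).
  by apply: measurable_funM => //; exact: reward_sum_measurable.
rewrite (_ : _ `&` _ = (\bigcap_(i in [set i | i \in J])
    (fun w => S i w - S istar w) @^-1` [set` `[0, +oo[]) `&` counts t nu).
  apply: measurableI; last exact: counts_measurable.
  apply: fin_bigcap_measurable => // i _.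
  by rewrite -[_ @^-1` _]setTI; apply: measurable_funB.
have mSE w i : counts t nu w -> m_emp Y arm t w 0 i = S i w.
  by move=> h; rewrite mxE h.
apply/seteqP; split=> w [h1 h2]; split => // i iJ /=.
  by have := h1 i iJ; rewrite in_itv/= andbT subr_ge0 !mSE.
by have := h1 i iJ; rewrite /= in_itv/= andbT subr_ge0 !mSE.
Qed.

Lemma p_emp_event_measurable t (S : set 'rV[R]_K) :
  measurable [set w | S (p_emp arm t w)].
Proof.
rewrite (_ : mkset _ = \bigcup_(nu in [set nu | S (freq t nu)]) counts t nu).
  by apply: fin_bigcup_measurable => // nu _; exact: counts_measurable.
apply/seteqP; split=> w /=.
  by move=> Sw; have [nu h] := counts_cover t w; exists nu => //=; rewrite -(counts_p_emp _ _ _ h).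
by move=> [nu /= Snu h]; rewrite (counts_p_emp _ _ _ h).
Qed.

Lemma alt_event_measurable t (S : set 'rV[R]_K) :
  measurable [set w | M (m_emp Y arm t w) /\ S (p_emp arm t w)].
Proof.
rewrite (_ : mkset _ = \bigcup_(nu in [set nu | S (freq t nu)])
    ([set w | M (m_emp Y arm t w)] `&` counts t nu)).
  by apply: fin_bigcup_measurable => // nu _; exact: alt_counts_measurable.
apply/seteqP; split=> w /=.
  move=> [Mw Sw]; have [nu h] := counts_cover t w.
  by exists nu => //=; rewrite -(counts_p_emp _ _ _ h).
by move=> [nu /= Snu [Mw h]]; rewrite (counts_p_emp _ _ _ h).
Qed.

Lemma alt_counts_le t nu a : (0 < t)%N -> ~ sublevel R K theta sigma istar J a (freq t nu) ->
  (P ([set w | M (m_emp Y arm t w)] `&` counts t nu) <= (expR (- (t%:R * a)))%:E)%E.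
Proof.
move=> t0 ha; set p := freq t nu.
have tp : 0 < t%:R :> R by rewrite ltr0n.
have p0 i : 0 <= p 0 i by rewrite mxE divr_ge0.
have [l bl hl] := @divergence_min R K theta sigma istar J sigma_gt0 p p0.
have al : a <= divergence R K theta sigma p l.
  by rewrite leNgt; apply/negP => h; apply: ha; exists l => //; exact: ltW.
(* The tilt moves the means from [theta] to the projection [l]. *)
pose c i := l 0 i - theta 0 i.
apply: (@likelihood_ratio_chernoff _ _ _ _ P theta sigma Y U arm sigma_gt0 mY lawY mU indepY na c t).
  exact: alt_counts_measurable.
move=> w [Mw hw]; rewrite /likelihood_ratio ler_expR sum_log_ratio.
apply: (@le_trans _ _ (t%:R * divergence R K theta sigma p l)); first by rewrite ler_pM2l.
have [Ml _] := bl.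
apply: (@le_trans _ _ (t%:R * \sum_i p 0 i * (c i * (m_emp Y arm t w 0 i - theta 0 i) / sigma ^+ 2
    - c i ^+ 2 / (2 * sigma ^+ 2)))).
  rewrite ler_pM2l//.
  exact: (@divergence_min_linear R K theta sigma istar J sigma_gt0 p l _ p0 Ml hl Mw).
rewrite mulr_sumr; apply: ler_sum => i _.
by rewrite mulrA hw mxE mulrCA divff ?gt_eqF// mulr1.
Qed.

Lemma alt_event_le t a : (0 < t)%N ->
  (P [set w | M (m_emp Y arm t w) /\
              ~ sublevel R K theta sigma istar J a (p_emp arm t w)]
   <= (t.+1%:R ^+ K * expR (- (t%:R * a)))%:E)%E.
Proof.
move=> t0; set bad := sublevel R K theta sigma istar J a.
pose E nu := [set w | M (m_emp Y arm t w) /\ ~ bad (freq t nu)] `&` counts t nu.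
(* The sublevel condition depends on [nu] alone, so each piece is empty or covered by
   [alt_counts_le]. *)
have EE nu : E nu = if `[< bad (freq t nu) >] then set0
    else [set w | M (m_emp Y arm t w)] `&` counts t nu.
  case: asboolP => h; apply/seteqP; split=> w //=; first by case=> -[].
    by case=> -[].
  by case.
have mE nu : measurable (E nu).
  by rewrite EE; case: ifP => // _; exact: alt_counts_measurable.
have hE nu : (P (E nu) <= (expR (- (t%:R * a)))%:E)%E.
  rewrite EE; case: asboolP => h; first by rewrite measure0 lee_fin expR_ge0.
  exact: alt_counts_le.
have := measure_finite_union_le _ _ _ P _ E _ mE hE.
rewrite card_ffun !card_ord natrX -EFinM; apply: le_trans.
apply: le_measure; rewrite ?inE.
- exact: (alt_event_measurable t (~` bad)).
- by apply: fin_bigcup_measurable.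
- move=> w /= [Mw bw]; have [nu h] := counts_cover t w.
  by exists nu => //; split => //; rewrite /= -(counts_p_emp _ _ _ h).
Qed.

End bandit_bound.

(** * Combination with the large deviation upper bound *)

Lemma simplex_closed (R : realType) (K : nat) : closed (simplex K : set 'rV[R]_K).
Proof.
rewrite (_ : simplex K = (\bigcap_(i in [set: 'I_K]) (fun p : 'rV[R]_K => p 0 i) @^-1` [set x | 0 <= x])
   `&` (fun p : 'rV[R]_K => \sum_(i < K) p 0 i) @^-1` [set 1]); last first.
  by apply/seteqP; split=> p [h1 h2]; split=> // i; [move=> _; exact: h1|exact: (h1 i I)].
apply: closedI.
  apply: closed_bigI => i _; apply: closed_comp; last exact: closed_ge.
  by move=> p _; exact: coord_continuous.
apply: closed_comp; last exact: closed_eq.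
suff : continuous (fun p : 'rV[R]_K => \sum_(i < K) p 0 i) by move=> h p _; exact: h.
apply: continuous_big; first exact: add_continuous.
by move=> i _ p; exact: coord_continuous.
Qed.

Lemma lee_real (R : realType) (x y : \bar R) :
  (forall a : R, a%:E < x -> a%:E <= y)%E -> (x <= y)%E.
Proof.
case: x => [x| |] h; last exact: leNye.
  apply/lee_subgt0Pr => e e0; rewrite -EFinB; apply: h.
  by rewrite lte_fin ltrBlDr ltrDl.
suff -> : y = +oo%E by [].
by apply/eqyP => a _; apply: h; exact: ltry.
Qed.

Theorem theorem2 (R : realType) (K : nat) (d : measure_display)
  (T : measurableType d) (P : probability T R)
  (theta : 'rV[R]_K) (sigma : R) (istar : 'I_K)
  (Y : nat -> 'I_K -> T -> R) (U : T -> R) (arm : nat -> T -> 'I_K)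
  (I : 'rV[R]_K -> \bar R) (n : nat) (J : {set 'I_K}) (Pset : set 'rV[R]_K) :
  0 < sigma ->
  (* theta in Theta, istar = I^* the unique best arm *)
  (forall i, i != istar -> theta 0 i < theta 0 istar) ->
  (* sampling model *)
  (forall t i, measurable_fun setT (Y t i)) ->
  (forall t i B, measurable B ->
     P (Y t i @^-1` B) = normal_prob (theta 0 i) sigma B) ->
  measurable_fun setT U ->
  mutually_independent P (all_vars Y U) ->
  (* non-anticipating algorithm *)
  non_anticipating Y arm U ->
  (* rate function I : Sigma_K -> [0, +oo] and LDP upper bound *)
  (forall p, simplex K p -> (0 <= I p)%E) ->
  LDP_upper P (p_emp arm) I ->
  (2 <= n <= K)%N -> #|J| = n -> istar \in J ->
  borel_rV K Pset -> Pset `<=` simplex K ->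
  let M := [set l : 'rV[R]_K | forall i, i \in J -> l 0 istar <= l 0 i] in
  ((limn_einf (fun t => - (t%:R^-1)%:E *
       eln (fine (P [set w | M (m_emp Y arm t w) /\ Pset (p_emp arm t w)]))))
  >= ereal_inf [set maxe (Frate sigma theta M p) (I p) | p in closure Pset])%E.
Proof.
move=> sigma_gt0 _ mY lawY mU indepY na _ [_ ldp] _ _ _ _ sP.
set M := [set l : 'rV[R]_K | forall i, i \in J -> l 0 istar <= l 0 i]; cbv zeta.
(* The infimum may be infinite, so it is approached through real numbers strictly below it. *)
apply: lee_real => a ha.
pose low := closure Pset `&` sublevel R K theta sigma istar J a.
have low_closed : closed low.
  by apply: closedI; [exact: closed_closure|exact: sublevel_closed].
have low_simplex : low `<=` simplex K.
  move=> p [+ _]; rewrite [simplex K](closure_id _).1; last exact: simplex_closed.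
  exact: closure_subset.
have := ldp _ low_closed low_simplex.
(* The LDP bound yields rate [a] once the infimum of [I] over [low] is shown to be at least [a],
   which is the last goal. *)
move=> /(@le_trans _ _ _ _ (- a)%:E) ldp_low.
apply: (@limn_einf_eln_ge R K (fun t => fine (P [set w | low (p_emp arm t w)]))).
- by move=> t; exact: fine_ge0.
- by move=> t; exact: fine_ge0.
- move=> t t0.
  have mlow := p_emp_event_measurable d T R K Y U arm mY mU na t low.
  have mPset := alt_event_measurable d T R K istar J Y U arm mY mU na t Pset.
  have mhigh := alt_event_measurable d T R K istar J Y U arm mY mU na t
    (~` sublevel R K theta sigma istar J a).
  rewrite -lee_fin EFinD !fineK ?fin_num_measure//.
  have hle := alt_event_le d T R K P theta sigma istar J Y U arm sigma_gt0 mY lawY mU indepY na t a t0.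
  apply: le_trans (leeD2l _ hle); 
  apply: le_trans (measureU2 _ mlow mhigh).
  apply: le_measure; rewrite ?inE//; first exact: measurableU.
  move=> w [Mw Pw]; have [h|h] := pselect (sublevel R K theta sigma istar J a (p_emp arm t w)).
    by left; split => //; exact: subset_closure.
  by right.
(* On [low] the value of [Frate] is at most [a], so a maximum above [a] must come from [I p]. *)
- apply: ldp_low; rewrite EFinN leeN2; apply: le_ereal_inf_tmp => _ [p [pP ps] <-].
  have : (a%:E < maxe (Frate sigma theta M p) (I p))%E.
    by apply: lt_le_trans ha _; apply: ereal_inf_lbound; exists p.
  rewrite lt_max => /orP[|/ltW//].
  by rewrite ltNge (@Frate_sublevel R K theta sigma istar J).
Qed.
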